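(* Let $n,d\ge2$ and $\mathcal T=\sum_{k=1}^{n+1}\mathbf v_k^{\otimes d}$. (i) If $d=2$, every $\mathbf v\in\mathbb R^n$ with $\|\mathbf v\|=1$ is an eigenvector of $\mathcal T$ with eigenvalue $\mu=1+\frac1n$. (ii) If $d\ge3$ is odd, $\mathbf v\in\mathbb R^n$ with $\|\mathbf v\|=1$ is an eigenvector of $\mathcal T$ if and only if there is a nonempty $K\subset\{1,\ldots,n+1\}$ with $|K|\le n$ such that $$\mathbf v=\frac{\sum_{k\in K}\mathbf v_k}{\|\sum_{k\in K}\mathbf v_k\|}=\frac{\sum_{k\in K}\mathbf v_k}{\sqrt{|K|(n+1-|K|)/n}},$$ and then the eigenvalue is $\mu=\dfrac{(n+1-|K|)^{d-1}-|K|^{d-1}}{n^{d/2}\,(|K|(n+1-|K|))^{d/2-1}}$. In particular $\mu=0$ exactly when $2|K|=n+1$, so for $n$ even all eigenvalues are nonzero. (iii) If $d\ge4$ is even, $\mathbf v\in\mathbb R^n$ with $\|\mathbf v\|=1$ is an eigenvector of $\mathcal T$ if and only if either (a) there is a nonempty $K\subset\{1,\ldots,n+1\}$ with $|K|\le n$ such that $\mathbf v=\sum_{k\in K}\mathbf v_k/\|\sum_{k\in K}\mathbf v_k\|$, with positive eigenvalue $\mu=\dfrac{(n+1-|K|)^{d-1}+|K|^{d-1}}{n^{d/2}(|K|(n+1-|K|))^{d/2-1}}$; or (b) there are nonempty disjoint $K_1,K_2\subset\{1,\ldots,n+1\}$, each of cardinality at most $n$, and numbers $0<a\le s^*<b\le1$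 with $|K_1|a+|K_2|b=1$ and $\frac{g(a)}{a}=\frac{g(b)}{b}$, such that $$\mathbf v=\frac{a\sum_{k\in K_1}\mathbf v_k+b\sum_{k\in K_2}\mathbf v_k}{\sqrt{\big((n+1)a^2|K_1|+(n+1)b^2|K_2|-1\big)/n}},$$ with positive eigenvalue $$\mu=\frac{|K_1|((n+1)a-1)^d+|K_2|((n+1)b-1)^d+n+1-|K_1|-|K_2|}{n^{d/2}\big((n+1)a^2|K_1|+(n+1)b^2|K_2|-1\big)^{d/2}}.$$
   Context: Simplex frame: for $n\ge 2$, $\mathbf v_k=\sqrt{1+\frac1n}\,\mathbf e_k-\frac{1}{n^{3/2}}(\sqrt{n+1}-1)\mathbf 1_n$ ($1\le k\le n$), $\mathbf v_{n+1}=-\frac{1}{\sqrt n}\mathbf 1_n$, with $\mathbf e_k$ unit vectors in $\mathbb R^n$, $\mathbf 1_n=(1,\ldots,1)^\top$; $\|\mathbf v_k\|=1$, $\langle\mathbf v_k,\mathbf v_j\rangle=-\frac1n$ ($k\ne j$), $\sum_k\mathbf v_k=\mathbf 0$. $\mathcal T=\sum_{k=1}^{n+1}\mathbf v_k^{\otimes d}$ with $(\mathbf v^{\otimes d})_{i_1\ldots i_d}=v_{i_1}\cdots v_{i_d}$; $\mathcal T\cdot\mathbf v^{d-1}=\sum_k\langle\mathbf v,\mathbf v_k\rangle^{d-1}\mathbf v_k$. $\mathbf v\ne\mathbf 0$ is an eigenvector with eigenvalue $\mu$ if $\mathcal T\cdot\mathbf v^{d-1}=\mu\mathbf v$. $g(s)=((n+1)s-1)^{d-1}-(-1)^{d-1}$.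 For even $d\ge4$, $s^*$ is the unique point in $[\frac1n,\frac2{n+1})$ such that $p(s)=g(s)/s$ is strictly decreasing on $[0,s^*]$ and strictly increasing on $[s^*,\infty)$. *)

(* Defs.v *)
From HB Require Import structures.
From mathcomp Require Import all_boot all_order all_algebra.
From mathcomp Require Import reals.
Set Implicit Arguments. Unset Strict Implicit. Unset Printing Implicit Defensive.
Import Order.TTheory GRing.Theory Num.Theory.
Local Open Scope ring_scope.

Section Simplex.
Variable R : realType.

Definition dotv n (u v : 'rV[R]_n) : R := \sum_(i < n) u 0 i * v 0 i.
Definition normv n (v : 'rV[R]_n) : R := Num.sqrt (dotv v v).

(* The simplex frame v_1, ..., v_{n+1}, indexed by k : 'I_n.+1
   (k = 0..n-1 correspond to v_1..v_n, k = n to v_{n+1}). *)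
Definition simplex_vec n (k : 'I_n.+1) : 'rV[R]_n :=
  if (val k < n)%N then
    \row_(i < n) (Num.sqrt (1 + (n%:R)^-1) * (val i == val k)%:R
                  - (Num.sqrt (n%:R + 1) - 1) / (Num.sqrt (n%:R) ^+ 3))
  else \row_(i < n) (- (Num.sqrt (n%:R))^-1).

Definition tensor n d := {ffun 'I_d -> 'I_n} -> R.

Definition tpow n d (v : 'rV[R]_n) : tensor n d :=
  fun f => \prod_(l < d) v 0 (f l).

Definition simplexT n d : tensor n d :=
  fun f => \sum_(k < n.+1) @tpow n d (simplex_vec k) f.

(* (T . v^{d-1})_i = sum_{i_2..i_d} T_{i i_2 .. i_d} v_{i_2} ... v_{i_d} *)
Definition tcontract n d (T : tensor n d) (v : 'rV[R]_n) : 'rV[R]_n :=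
  \row_(i < n) \sum_(f : {ffun 'I_d -> 'I_n} |
                     [forall l : 'I_d, (val l == 0%N) ==> (f l == i)])
                 (T f * \prod_(l : 'I_d | val l != 0%N) v 0 (f l)).

Definition eigenpair n d (T : tensor n d) (v : 'rV[R]_n) (mu : R) : Prop :=
  v != 0 /\ tcontract T v = mu *: v.

Definition is_eigenvector n d (T : tensor n d) (v : 'rV[R]_n) : Prop :=
  exists mu, eigenpair T v mu.

Definition sumK n (K : {set 'I_n.+1}) : 'rV[R]_n := \sum_(k in K) simplex_vec k.

Definition gfun (n d : nat) (s : R) : R :=
  ((n%:R + 1) * s - 1) ^+ d.-1 - (-1) ^+ d.-1.

Definition is_sstar (n d : nat) (s : R) : Prop :=
  (n%:R)^-1 <= s /\ s < 2 / (n%:R + 1) /\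
  (forall x y, 0 < x -> x < y -> y <= s -> gfun n d y / y < gfun n d x / x) /\
  (forall x y, s <= x -> x < y -> gfun n d x / x < gfun n d y / y).

End Simplex.

Arguments simplexT R n d : clear implicits.
Arguments sumK {R n} K.
Arguments simplex_vec {R n} k.

(* Main.v *)
(** Because the v_k form a tight frame whose only linear relations are multiples
    of sum v_k = 0, every unit vector is the direction of sum s_k v_k for weights
    s_k >= 0 of sum 1, at least one of them zero.  Comparing coefficients in
    sum <v, v_k>^(d-1) v_k = mu v, such a direction is an eigenvector iff
    g (s_k) = lam s_k for a constant lam and all k.  For odd d strict convexity
    leaves room for a single nonzero weight value.  For even d, g(s)/s is injective
    on each side of s*, so at most two nonzero values a <= s* < b occur.  The
    formula for mu in case (b) comes from
    sum (N s_k - 1)^d = sum (N s_k - 1)(lam s_k - 1) = lam Q, where N = n + 1. *)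

Require Import Defs.
From HB Require Import structures.
From mathcomp Require Import all_boot all_order all_algebra.
From mathcomp Require Import reals.
From mathcomp Require Import ring lra.
Import Order.TTheory GRing.Theory Num.Theory.
Local Open Scope ring_scope.

(** * The simplex frame: Gram matrix, tight frame identity, contraction with the tensor *)

Section SimplexFrame.
Context {R : realType} {n : nat}.
Hypothesis n_gt0 : (0 < n)%N.
Implicit Types (u v w : 'rV[R]_n) (s : 'I_n.+1 -> R) (K : {set 'I_n.+1}).

Local Notation N := (n%:R + 1 : R).

Lemma dotvC u v : dotv u v = dotv v u.
Proof. by apply: eq_bigr => i _; rewrite mulrC. Qed.

Lemma dotvZl a u v : dotv (a *: u) v = a * dotv u v.
Proof. by rewrite /dotv mulr_sumr; apply: eq_bigr => i _; rewrite mxE mulrA. Qed.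

Lemma dotv_suml (I : finType) (F : I -> 'rV[R]_n) v :
  dotv (\sum_i F i) v = \sum_i dotv (F i) v.
Proof.
rewrite /dotv exchange_big; apply: eq_bigr => j _ /=.
by rewrite summxE mulr_suml.
Qed.

Lemma normvZ a v : 0 <= a -> normv (a *: v) = a * normv v.
Proof.
move=> a_ge0; rewrite /normv dotvZl dotvC dotvZl mulrA -expr2.
by rewrite sqrtrM ?sqr_ge0 // sqrtr_sqr ger0_norm.
Qed.

Lemma normv0 : normv (0 : 'rV[R]_n) = 0.
Proof. by rewrite /normv /dotv big1 ?sqrtr0 // => i _; rewrite mxE mul0r. Qed.

Let sn := Num.sqrt (n%:R : R).
Let sN := Num.sqrt N.

Let n_pos : 0 < n%:R :> R. Proof. by rewrite ltr0n. Qed.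
Let n_neq0 : n%:R != 0 :> R. Proof. by rewrite gt_eqF. Qed.
Let N_pos : 0 < N. Proof. by rewrite ltr_pwDr // ltW. Qed.
Let N_neq0 : N != 0. Proof. by rewrite gt_eqF. Qed.
Let sn_neq0 : sn != 0. Proof. by rewrite gt_eqF // sqrtr_gt0. Qed.
Let sn2 : sn ^+ 2 = n%:R. Proof. by rewrite sqr_sqrtr // ltW. Qed.
Let sN2 : sN ^+ 2 = N. Proof. by rewrite sqr_sqrtr // ltW. Qed.

(** With sqrt(1 + 1/n) written as [sN / sn], all coordinates are rational in [sn] and [sN], so
    [field] can settle identities between them, given [sn ^+ 2 = sN ^+ 2 - 1]. *)
Let diag := sN / sn.
Let shift := (sN - 1) / sn ^+ 3.

Lemma simplex_vecE (k : 'I_n.+1) i : simplex_vec k 0 i =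
  if (k < n)%N then diag * (val i == val k)%:R - shift else - sn^-1 :> R.
Proof.
have -> : diag = Num.sqrt (1 + n%:R^-1).
  by rewrite /diag /sN /sn -sqrtrV ?ltW// -sqrtrM ?ltW// mulrDl mul1r divff.
by rewrite /simplex_vec; case: ifP; rewrite mxE.
Qed.

Lemma simplex_vec_widen (k i : 'I_n) :
  simplex_vec (widen_ord (leqnSn n) k) 0 i = diag * (i == k)%:R - shift :> R.
Proof. by rewrite simplex_vecE /= ltn_ord. Qed.

Lemma simplex_vec_max (i : 'I_n) : simplex_vec ord_max 0 i = - sn^-1 :> R.
Proof. by rewrite simplex_vecE /= ltnn. Qed.

Let shift_sum : \sum_(i < n) shift = n%:R * shift.
Proof. by rewrite sumr_const card_ord mulr_natl. Qed.

Let delta_sum (k : 'I_n) (F : 'I_n -> R) : \sum_(i < n) (i == k)%:R * F i = F k.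
Proof.
rewrite (bigD1 k) //= eqxx mul1r big1 ?addr0 // => i /negbTE->.
by rewrite mul0r.
Qed.

(** The coordinate matrix of v_1, ..., v_n is symmetric, so this one computation gives both their
    inner products and, in [simplex_tight_frame], the sum over these vectors for two fixed
    coordinates. *)
Let row_gram (k j : 'I_n) :
  \sum_(i < n) (diag * (i == k)%:R - shift) * (diag * (i == j)%:R - shift)
  = (N * (k == j)%:R - 1) / n%:R.
Proof.
transitivity (\sum_(i < n) ((i == k)%:R * (diag ^+ 2 * (i == j)%:R - diag * shift)
   + (i == j)%:R * (- (diag * shift)) + shift ^+ 2)).
  by apply: eq_bigr => i _; ring.
rewrite !big_split /= !delta_sum sumr_const card_ord -[_ *+ n]mulr_natl.
case: (k == j) => /=; rewrite /diag /shift -sN2 -!sn2 ?(mulr0, mulr1).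
all: have e : sn ^+ 2 = sN ^+ 2 - 1 by rewrite sN2 sn2 addrK.
all: by field: e.
Qed.

Lemma dotv_simplex (k j : 'I_n.+1) :
  dotv (simplex_vec k) (simplex_vec j) = (N * (k == j)%:R - 1) / n%:R :> R.
Proof.
have lift_vec (l i : 'I_n) :
    simplex_vec (lift ord_max l) 0 i = diag * (i == l)%:R - shift :> R.
  rewrite -simplex_vec_widen; congr (simplex_vec _ 0 i).
  by apply: val_inj; rewrite /= /bump leqNgt ltn_ord.
have row_sum (l : 'I_n) :
    \sum_(i < n) simplex_vec (lift ord_max l) 0 i * simplex_vec ord_max 0 i
    = - n%:R^-1 :> R.
  transitivity (\sum_(i < n) ((i == l)%:R * (- (diag / sn)) + shift / sn)).
    by apply: eq_bigr => i _; rewrite lift_vec simplex_vec_max; ring.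
  rewrite big_split /= delta_sum sumr_const card_ord -[_ *+ n]mulr_natl.
  by rewrite /diag /shift -sn2; field.
case: (unliftP ord_max k) => [{}k ->|->]; case: (unliftP ord_max j) => [{}j ->|->].
- rewrite (inj_eq lift_inj) -row_gram.
  by apply: eq_bigr => i _; rewrite !lift_vec.
- by rewrite eq_sym (negbTE (neq_lift _ _)) mulr0 sub0r mulN1r -(row_sum k).
- by rewrite (negbTE (neq_lift _ _)) mulr0 sub0r mulN1r dotvC -(row_sum j).
- rewrite eqxx mulr1 addrK divff // /dotv.
  under eq_bigr do rewrite simplex_vec_max.
  by rewrite sumr_const card_ord -[_ *+ n]mulr_natl -sn2; field.
Qed.

Lemma sum_simplex_vec : \sum_k simplex_vec k = 0 :> 'rV[R]_n.
Proof.
apply/rowP => i; rewrite summxE mxE big_ord_recr /= simplex_vec_max.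
under eq_bigr do rewrite simplex_vec_widen eq_sym mulrC.
rewrite big_split /= delta_sum sumrN shift_sum.
by rewrite /diag /shift -sn2; field.
Qed.

Lemma simplex_tight_frame v :
  \sum_k dotv v (simplex_vec k) *: simplex_vec k = (N / n%:R) *: v.
Proof.
apply/rowP => i; rewrite summxE mxE.
transitivity (\sum_(l < n) v 0 l * (N / n%:R * (l == i)%:R)).
  transitivity (\sum_(l < n) v 0 l *
      \sum_k simplex_vec k 0 l * simplex_vec k 0 i).
    under eq_bigr do rewrite mxE /dotv mulr_suml.
    rewrite exchange_big; apply: eq_bigr => l _ /=.
    by rewrite mulr_sumr; apply: eq_bigr => k _; rewrite mulrA.
  apply: eq_bigr => l _; congr (_ * _).
  (* The last vector contributes 1/n, which cancels the -1/n of [row_gram] and leaves N/n times the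
     identity matrix. *)
  rewrite big_ord_recr /= !simplex_vec_max mulrNN.
  under eq_bigr do rewrite !simplex_vec_widen eq_sym [i == _]eq_sym.
  by rewrite row_gram -sn2; field.
under eq_bigr do rewrite mulrCA mulrA mulrC.
by rewrite delta_sum mulrC.
Qed.

(** The condition that index 0 equals i becomes a factor of slot 0. The sum over index functions of
    a product over slots then factors by distributivity: slot 0 yields coordinate i of v_k, each of
    the other d slots yields <v, v_k>. *)
Lemma tcontract_simplexT d v :
  tcontract (simplexT R n d.+1) v
  = \sum_k dotv v (simplex_vec k) ^+ d *: simplex_vec k.
Proof.
apply/rowP => i; rewrite mxE summxE.
transitivity (\sum_(k < n.+1) \sum_(f : {ffun 'I_d.+1 -> 'I_n})
   \prod_l (if l == ord0 then (f l == i)%:R * simplex_vec k 0 (f l)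
            else simplex_vec k 0 (f l) * v 0 (f l))).
  rewrite exchange_big big_mkcond; apply: eq_bigr => f _ /=.
  have -> : [forall l : 'I_d.+1, (val l == 0%N) ==> (f l == i)] = (f ord0 == i).
    apply/forallP/idP => [/(_ ord0) //|fi l]; apply/implyP => l0.
    by rewrite (_ : l = ord0) //; apply/val_inj/eqP.
  under [RHS]eq_bigr => k _ do rewrite (bigD1 ord0) //=.
  case: eqP => _; last first.
    by rewrite big1 // => k _; rewrite !mul0r.
  rewrite mulr_suml; apply: eq_bigr => k _; rewrite mul1r.
  rewrite /tpow (bigD1 ord0) //= -mulrA -big_split; congr (_ * _).
  by apply: eq_bigr => l /negbTE ->.
apply: eq_bigr => k _; rewrite mxE.
rewrite -(bigA_distr_bigA (fun l j => if l == ord0 then (j == i)%:R * simplex_vec k 0 j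
            else simplex_vec k 0 j * v 0 j)) /=.
rewrite big_ord_recl /= delta_sum mulrC; congr (_ * _).
rewrite -[in RHS](card_ord d) -prodr_const; apply: eq_bigr => l _.
by apply: eq_bigr => j _; rewrite mulrC.
Qed.

(** * Weighted combinations of the frame and the weights of a unit vector *)

Definition simplex_comb s : 'rV[R]_n := \sum_k s k *: simplex_vec k.

Lemma dotv_simplex_comb s j :
  dotv (simplex_comb s) (simplex_vec j) = (N * s j - \sum_k s k) / n%:R.
Proof.
rewrite dotv_suml.
transitivity (\sum_k ((k == j)%:R * (N / n%:R * s k) - s k / n%:R)).
  by apply: eq_bigr => k _; rewrite dotvZl dotv_simplex; ring.
rewrite big_split /= sumrN -mulr_suml (bigD1 j) //= eqxx mul1r.
rewrite big1 ?addr0 => [|k /negbTE ->]; last by rewrite mul0r.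
by ring.
Qed.

Lemma dotv_simplex_comb2 s :
  dotv (simplex_comb s) (simplex_comb s)
  = (N * \sum_k s k ^+ 2 - (\sum_k s k) ^+ 2) / n%:R.
Proof.
rewrite {2}/simplex_comb dotvC dotv_suml.
transitivity (\sum_k (N / n%:R * s k ^+ 2 - s k * ((\sum_j s j) / n%:R))).
  by apply: eq_bigr => k _; rewrite dotvZl dotvC dotv_simplex_comb; ring.
by rewrite big_split /= sumrN -mulr_suml -mulr_sumr; ring.
Qed.

(** Pairing with v_j recovers s_j up to the common sum. Applied to a difference of two combinations,
    this is what allows coefficients to be compared up to a constant. *)
Lemma simplex_comb_eq0 s : simplex_comb s = 0 -> forall j, N * s j = \sum_k s k.
Proof.
move=> s0 j; apply/eqP; rewrite -subr_eq0.
have /eqP : dotv (simplex_comb s) (simplex_vec j) = 0.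
  by rewrite s0 /dotv big1 // => i _; rewrite mxE mul0r.
by rewrite dotv_simplex_comb mulf_eq0 invr_eq0 (negbTE n_neq0) orbF.
Qed.

Lemma simplex_combZ a s : a *: simplex_comb s = simplex_comb (fun k => a * s k).
Proof. by rewrite scaler_sumr; apply: eq_bigr => k _; rewrite scalerA. Qed.

Lemma simplex_combB s t :
  simplex_comb s - simplex_comb t = simplex_comb (fun k => s k - t k).
Proof. by rewrite -sumrB; apply: eq_bigr => k _; rewrite scalerBl. Qed.

Lemma simplex_comb_const a : simplex_comb (fun=> a) = 0.
Proof. by rewrite /simplex_comb -scaler_sumr sum_simplex_vec scaler0. Qed.

Lemma simplex_comb_sumK K : simplex_comb (fun k => (k \in K)%:R) = sumK K.
Proof.
rewrite /sumK big_mkcond; apply: eq_bigr => k _.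
by case: ifP => _; rewrite ?scale1r ?scale0r.
Qed.

Definition simplex_dir s : 'rV[R]_n := (normv (simplex_comb s))^-1 *: simplex_comb s.

(** Allows a change between weights of sum 1, needed for the eigenvector equation, and the 0/1
    weights behind [sumK]. *)
Lemma simplex_dirZ a s : 0 < a -> simplex_dir (fun k => a * s k) = simplex_dir s.
Proof.
move=> a_gt0; rewrite /simplex_dir -simplex_combZ normvZ ?ltW// scalerA.
by rewrite invfM mulrAC mulVf ?mul1r // gt_eqF.
Qed.

(* The coefficients are <v, v_k>, shifted so that the least one is 0 (which
   leaves v unchanged as the v_k sum to 0) and rescaled to sum 1. *)
Lemma unit_simplex_dir v : normv v = 1 ->
  exists s, [/\ \sum_k s k = 1, forall k, 0 <= s k, exists k, s k = 0
              & v = simplex_dir s].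
Proof.
move=> v1; pose c k := dotv v (simplex_vec k).
have vE : v = simplex_comb (fun k => n%:R / N * c k).
  rewrite -simplex_combZ [simplex_comb _]simplex_tight_frame scalerA.
  by rewrite mulrA mulfVK // divff // scale1r.
have c_sum : \sum_k c k = 0.
  rewrite /c; under eq_bigr do rewrite dotvC.
  rewrite -dotv_suml sum_simplex_vec /dotv big1 // => i _.
  by rewrite mxE mul0r.
pose k0 := [arg min_(k < ord0) c k]%O.
have c_min k : c k0 <= c k.
  by rewrite /k0; case: Order.TotalTheory.arg_minP => //= i _; apply.
(* Otherwise the coefficients are nonnegative with sum 0, so all vanish and v = 0. *)
have c0_lt0 : c k0 < 0.
  rewrite ltNge; apply/negP => c0_ge0.
  have c0 : forall k, c k = 0.
    move=> k; apply/eqP; move: (c_sum) => /eqP.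
    rewrite psumr_eq0 => [/allP/(_ k)|j _]; last exact: le_trans (c_min j).
    by rewrite mem_index_enum; apply.
  move: v1; rewrite vE /simplex_comb big1 => [|k _].
    by rewrite normv0 => /esym/eqP; rewrite oner_eq0.
  by rewrite c0 mulr0 scale0r.
have c0_neq0 : c k0 != 0 by rewrite lt_eqF.
(* The denominator is the sum of the shifted coefficients, because the c k add up to 0 over N
   indices. *)
pose s k := (c k - c k0) / (- (N * c k0)).
have den_gt0 : 0 < - (N * c k0) by rewrite oppr_gt0 pmulr_rlt0.
exists s; split.
- rewrite /s -mulr_suml sumrB c_sum sumr_const card_ord -[_ *+ n.+1]mulr_natl -natr1.
  by field; rewrite c0_neq0 /=.
- by move=> k; rewrite divr_ge0 ?subr_ge0 // ltW.
- by exists k0; rewrite /s subrr mul0r.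
have -> : v = (normv v)^-1 *: v by rewrite v1 invr1 scale1r.
have <- : (n%:R * - c k0) *: simplex_comb s = v.
  rewrite vE simplex_combZ; apply/eqP; rewrite -subr_eq0 simplex_combB.
  rewrite -[X in _ == X](simplex_comb_const (- (n%:R / N * c k0))); apply/eqP.
  apply: eq_bigr => k _; congr (_ *: _).
  by rewrite /s; field; rewrite N_neq0.
by rewrite simplex_combZ; apply: simplex_dirZ; rewrite mulr_gt0 // oppr_gt0.
Qed.

Lemma simplex_comb_neq0 s k0 : \sum_k s k = 1 -> N * s k0 != 1 ->
  simplex_comb s != 0.
Proof.
by move=> s1; apply: contra_neq => /simplex_comb_eq0 ->.
Qed.

Lemma normv_simplex_comb s : \sum_k s k = 1 ->
  normv (simplex_comb s) = Num.sqrt ((N * (\sum_k s k ^+ 2) - 1) / n%:R).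
Proof. by move=> s1; rewrite /normv dotv_simplex_comb2 s1 expr1n. Qed.

(** Up to the positive factor N n, the squared norm is the sum of the squares (N s_k - 1)^2, and its
    k0 term is already positive. *)
Lemma normv_simplex_comb_gt0 s k0 : \sum_k s k = 1 -> N * s k0 != 1 ->
  0 < normv (simplex_comb s).
Proof.
move=> s1 s0; rewrite normv_simplex_comb // sqrtr_gt0 pmulr_lgt0 ?invr_gt0 //.
have sq : \sum_k (N * s k - 1) ^+ 2 = N * (N * (\sum_k s k ^+ 2) - 1).
  transitivity (\sum_k (N ^+ 2 * s k ^+ 2 - (2 * N) * s k + 1)).
    by apply: eq_bigr => k _; ring.
  rewrite !big_split /= sumrN -!mulr_sumr s1 sumr_const card_ord -[_ *+ n.+1]mulr_natl -natr1.
  by ring.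
rewrite -(pmulr_rgt0 _ N_pos) -sq (bigD1 k0) //= ltr_pwDl //.
  by rewrite exprn_even_gt0 //= subr_eq0.
by apply: sumr_ge0 => k _; rewrite sqr_ge0.
Qed.

(** * The eigenvector equation as a condition on the weights *)

Lemma tcontractZ d (a : R) v :
  tcontract (simplexT R n d.+1) (a *: v)
  = a ^+ d *: tcontract (simplexT R n d.+1) v.
Proof.
rewrite !tcontract_simplexT scaler_sumr; apply: eq_bigr => k _.
by rewrite dotvZl exprMn scalerA.
Qed.

Lemma tcontract_simplex_comb d s : \sum_k s k = 1 ->
  tcontract (simplexT R n d.+1) (simplex_comb s)
  = simplex_comb (fun k => ((N * s k - 1) / n%:R) ^+ d).
Proof.
move=> s1; rewrite tcontract_simplexT; apply: eq_bigr => k _.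
by rewrite dotv_simplex_comb s1.
Qed.

(** Both sides of the eigenvector equation are combinations of the v_k, so their coefficients differ
    by a constant independent of k. At k0, where the weight is 0, that constant is, up to scaling,
    the power of -1 subtracted in [gfun]. *)
Lemma eigenvector_gfun_linear d s k0 : \sum_k s k = 1 -> s k0 = 0 ->
  is_eigenvector (simplexT R n d.+1) (simplex_dir s) ->
  exists lam, forall k, gfun n d.+1 (s k) = lam * s k.
Proof.
move=> s1 s0 [mu [dir_neq0]]; rewrite /simplex_dir tcontractZ tcontract_simplex_comb //.
have rho_neq0 : (normv (simplex_comb s))^-1 != 0.
  by apply: contra_neq dir_neq0; rewrite /simplex_dir => ->; rewrite scale0r.
move: rho_neq0; set rho := (normv _)^-1 => rho_neq0 /eqP.
rewrite scalerA !simplex_combZ -subr_eq0 simplex_combB => /eqP/simplex_comb_eq0 eqc.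
exists (n%:R ^+ d / rho ^+ d * (mu * rho)) => k.
have /(mulfI N_neq0) := etrans (eqc k) (esym (eqc k0)).
rewrite s0 !mulr0 subr0 sub0r !expr_div_n => e0.
have e : rho ^+ d * ((N * s k - 1) ^+ d / n%:R ^+ d)
    - rho ^+ d * ((-1) ^+ d / n%:R ^+ d) = mu * rho * s k by rewrite -e0; ring.
have : n%:R ^+ d * rho ^+ d * gfun n d.+1 (s k)
     = n%:R ^+ d * rho ^+ d * (n%:R ^+ d / rho ^+ d * (mu * rho) * s k).
  have nd : n%:R ^+ d != 0 :> R by rewrite expf_neq0.
  have rd : rho ^+ d != 0 by rewrite expf_neq0.
  transitivity (n%:R ^+ d * n%:R ^+ d * (mu * rho * s k)); last by field.
  by rewrite -e /gfun /=; field.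
by apply/mulfI; rewrite mulf_neq0 // expf_neq0.
Qed.

(** Converse direction: the power of -1 subtracted in [gfun] is the same for all k, so it only
    contributes a multiple of sum v_k = 0. *)
Lemma gfun_linear_eigenpair d s k0 lam : \sum_k s k = 1 -> N * s k0 != 1 ->
  (forall k, gfun n d.+2 (s k) = lam * s k) ->
  eigenpair (simplexT R n d.+2) (simplex_dir s)
    (lam / (n%:R ^+ d.+1 * normv (simplex_comb s) ^+ d)).
Proof.
move=> s1 s0 gl; have r_gt0 := normv_simplex_comb_gt0 _ _ s1 s0; split.
  by rewrite scaler_eq0 negb_or invr_eq0 gt_eqF //= (simplex_comb_neq0 _ _ s1 s0).
rewrite tcontractZ tcontract_simplex_comb // /simplex_dir scalerA !simplex_combZ.
move: r_gt0; set r := normv _ => r_gt0.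
have rd : r ^+ d != 0 by rewrite expf_neq0 // gt_eqF.
have nd : n%:R ^+ d.+1 != 0 :> R by rewrite expf_neq0.
have r_neq0 : r != 0 by rewrite gt_eqF.
apply/eqP; rewrite -subr_eq0 simplex_combB; apply/eqP.
rewrite -[RHS](simplex_comb_const ((-1) ^+ d.+1 / (r ^+ d.+1 * n%:R ^+ d.+1))).
apply: eq_bigr => k _; congr (_ *: _).
have -> : ((N * s k - 1) / n%:R) ^+ d.+1 = (lam * s k + (-1) ^+ d.+1) / n%:R ^+ d.+1.
  by rewrite expr_div_n -gl /gfun /= subrK.
rewrite exprVn ![r ^+ d.+1]exprS; move: rd nd.
set x := r ^+ d; set y := n%:R ^+ d.+1; set z := (-1) ^+ d.+1 => x0 y0.
by field; rewrite y0 x0.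
Qed.

(** * One nonzero weight value: normalized sums over a set of frame vectors *)

Lemma eq_simplex_dir s t : s =1 t -> simplex_dir s = simplex_dir t.
Proof.
move=> st; rewrite /simplex_dir (_ : simplex_comb s = simplex_comb t) //.
by apply: eq_bigr => k _; rewrite st.
Qed.

Lemma simplex_dir_sumK K :
  simplex_dir (fun k => (k \in K)%:R) = (normv (sumK K))^-1 *: sumK K.
Proof. by rewrite /simplex_dir simplex_comb_sumK. Qed.

Lemma sum_mem K (a : R) : \sum_k a * (k \in K)%:R = #|K|%:R * a.
Proof.
rewrite -mulr_sumr mulrC; congr (_ * _).
by rewrite -sum1_card natr_sum [RHS]big_mkcond /=; apply: eq_bigr => k _; case: ifP.
Qed.

Lemma normv_sumK K :
  normv (sumK K) = Num.sqrt (#|K|%:R * (N - #|K|%:R) / n%:R).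
Proof.
rewrite /normv -simplex_comb_sumK dotv_simplex_comb2.
have sum1 : \sum_k (k \in K)%:R = #|K|%:R :> R.
  by rewrite -[RHS]mulr1 -sum_mem; under [RHS]eq_bigr do rewrite mul1r.
rewrite [X in N * X](_ : _ = #|K|%:R) ?sum1; first by congr (Num.sqrt (_ / _)); ring.
rewrite -sum1; apply: eq_bigr => k _.
by case: (k \in K); rewrite ?expr1n ?expr0n.
Qed.

Lemma notin_of_card K : (#|K| <= n)%N -> exists k, k \notin K.
Proof.
move=> Kn; have /subsetPn[k _ kK] : ~~ ([set: 'I_n.+1] \subset K).
  by apply/negP => /subset_leq_card; rewrite cardsT card_ord leqNgt ltnS Kn.
by exists k.
Qed.

Lemma card_of_notin K k : k \notin K -> (#|K| <= n)%N.
Proof.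
move=> kK; have : K \subset [set~ k].
  by apply/subsetP => j jK; rewrite !inE; apply: contraNneq kK => <-.
by move=> /subset_leq_card; rewrite cardsC1 card_ord.
Qed.

(** Weights 1/k on K satisfy g(s) = lam s with lam = k g(1/k), because g(0) = 0. Keeping the sign
    inside [(- k) ^+ d.+1] and the square roots in the denominator makes one formula serve both
    parities. *)
Lemma eigenpair_sumK d K : K != set0 -> (#|K| <= n)%N ->
  let k := #|K|%:R : R in
  eigenpair (simplexT R n d.+2) ((normv (sumK K))^-1 *: sumK K)
    (((N - k) ^+ d.+1 - (- k) ^+ d.+1)
     / (Num.sqrt n%:R ^+ d.+2 * Num.sqrt (k * (N - k)) ^+ d)).
Proof.
move=> K0 Kn k; have [k0 k0K] := notin_of_card _ Kn.
have k_gt0 : 0 < k by rewrite ltr0n card_gt0.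
have k_neq0 : k != 0 by rewrite gt_eqF.
have Nk_gt0 : 0 < N - k by rewrite subr_gt0 natr1 ltr_nat ltnS.
pose s j : R := k^-1 * (j \in K)%:R.
have s1 : \sum_j s j = 1 by rewrite sum_mem divff.
have s0 : N * s k0 != 1.
  by rewrite /s (negbTE k0K) !mulr0 eq_sym oner_eq0.
have gl j : gfun n d.+2 (s j) = k * gfun n d.+2 k^-1 * s j.
  rewrite /s; case: (j \in K); first by rewrite mulr1; field.
  by rewrite !mulr0 /gfun mulr0 sub0r subrr.
have := gfun_linear_eigenpair _ _ _ _ s1 s0 gl.
rewrite simplex_dirZ ?invr_gt0 // simplex_dir_sumK; congr eigenpair.
rewrite -simplex_combZ simplex_comb_sumK normvZ ?invr_ge0 ?ltW // normv_sumK.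
rewrite sqrtrM ?mulr_ge0 ?ltW // sqrtrV ?ltW //.
set S := Num.sqrt (k * _); rewrite -/sn.
have S_neq0 : S != 0 by rewrite gt_eqF // sqrtr_gt0 mulr_gt0.
have -> : k * gfun n d.+2 k^-1 = ((N - k) ^+ d.+1 - (- k) ^+ d.+1) / k ^+ d.
  have -> : N - k = k * (N * k^-1 - 1) by field.
  rewrite -[- k]mulrN1 !exprMn /gfun /= [k ^+ d.+1]exprS.
  move: (expf_neq0 d k_neq0) (_ ^+ d.+1) ((-1) ^+ d.+1); set x := k ^+ d => x0 y z.
  by field.
rewrite !exprMn !exprVn -sn2 exprAC expr2 !exprS.
have := expf_neq0 d S_neq0; have := expf_neq0 d k_neq0; have := expf_neq0 d sn_neq0.
move: (sn ^+ d) (k ^+ d) (S ^+ d) => x y z x0 y0 z0.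
by field; rewrite sn_neq0 x0 y0 z0.
Qed.

Lemma simplex_dir_one_level s K a k0 :
  \sum_k s k = 1 -> s k0 = 0 -> 0 < a -> (forall k, s k = a * (k \in K)%:R) ->
  [/\ K != set0, (#|K| <= n)%N & simplex_dir s = (normv (sumK K))^-1 *: sumK K].
Proof.
move=> s1 s0 a_gt0 sE; split.
- apply/eqP => K0; move: s1; rewrite big1 => [/eqP|k _].
    by rewrite eq_sym oner_eq0.
  by rewrite sE K0 inE mulr0.
- apply: (@card_of_notin K k0); apply/negP => k0K.
  by move/eqP: s0; rewrite sE k0K mulr1 gt_eqF.
- by rewrite (eq_simplex_dir _ _ sE) simplex_dirZ // simplex_dir_sumK.
Qed.

End SimplexFrame.

(** * Uniqueness of eigenvalues, and how often g(s) = lam s can hold *)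

Lemma eigenvalue_uniq (R : realType) n d (T : tensor R n d) v mu nu :
  eigenpair T v mu -> eigenpair T v nu -> mu = nu.
Proof.
move=> [v0 e1] [_ e2]; apply/eqP; rewrite -subr_eq0.
have /eqP : (mu - nu) *: v = 0 by rewrite scalerBl -e1 -e2 subrr.
by rewrite scaler_eq0 (negbTE v0) orbF.
Qed.

(** Induction: with p = m + 2, multiplying the bound by u exceeds the next bound by p (u - 1)^2. *)
Lemma bernoulli_strict {R : realFieldType} (m : nat) (u : R) :
  0 <= u -> u != 1 -> 1 + m.+2%:R * (u - 1) < u ^+ m.+2.
Proof.
move=> u_ge0 u1; have sq : 0 < (u - 1) ^+ 2.
  by rewrite exprn_even_gt0 //= subr_eq0.
elim: m => [|m IHm]; first by rewrite -subr_gt0; move: sq; congr (0 < _); ring.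
rewrite [ltRHS]exprS; apply: lt_le_trans (ler_wpM2l u_ge0 (ltW IHm)).
have m_gt0 : 0 < m.+2%:R :> R by rewrite ltr0n.
by rewrite -[m.+3%:R]natr1 -subr_gt0; move: (mulr_gt0 m_gt0 sq); congr (0 < _); ring.
Qed.

(** For y != 0, division by y^(m+2) > 0 turns the claim into Bernoulli's inequality for u = x / y.
    When u < 0 the linear side is negative and the even power is not. *)
Lemma even_pow_above_tangent {R : realFieldType} (m : nat) (x y : R) :
  ~~ odd m -> x != y -> y ^+ m.+2 + m.+2%:R * y ^+ m.+1 * (x - y) < x ^+ m.+2.
Proof.
move=> em xy; have [y0|y0] := eqVneq y 0.
  rewrite y0 !expr0n /= mulr0 mul0r addr0.
  by rewrite exprn_even_gt0 ?negbK//= -y0.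
have ym : 0 < y ^+ m.+2 by rewrite exprn_even_gt0 ?negbK.
pose u := x / y; have xE : x = u * y by rewrite /u divfK.
have u1 : u != 1 by apply: contra_neq xy => u1; rewrite xE u1 mul1r.
suff: 1 + m.+2%:R * (u - 1) < u ^+ m.+2.
  rewrite -(ltr_pM2r ym) -exprMn -xE.
  by congr (_ < _); rewrite xE !exprS; ring.
have [u0|u0] := leP 0 u; first exact: bernoulli_strict.
apply: lt_le_trans (exprn_even_ge0 _ _); last by rewrite /= negbK.
have : 1 <= m.+2%:R :> R by rewrite ler1n.
by nra.
Qed.

(* The line t |-> lam t + 1 meets the strictly convex t |-> (N t - 1)^m, m even,
   at most twice, and one of the two points is t = 0. *)
Lemma gfun_odd_linear_inj {R : realType} (n d : nat) (lam a b : R) : ~~ odd d ->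
  0 < a -> 0 < b -> gfun n d.+3 a = lam * a -> gfun n d.+3 b = lam * b -> a = b.
Proof.
move=> ed; wlog ab : a b / a <= b => [hw a0 b0 ea eb|].
  by have [ab|/ltW ab] := leP a b; [|symmetry]; apply: hw.
move=> a0 b0; rewrite /gfun /= -signr_odd /= negbK (negbTE ed) expr0.
set N := n%:R + 1 => /eqP; rewrite subr_eq => /eqP ea /eqP.
rewrite subr_eq => /eqP eb; move: ab; rewrite le_eqVlt => /predU1P[//|ab].
have N_gt0 : 0 < N by rewrite ltr_wpDl.
have neq c : c != a -> N * c - 1 != N * a - 1.
  by apply: contra_neq => /addIr/(mulfI (lt0r_neq0 N_gt0)).
have h0 : 0 != a by rewrite lt_eqF.
have hb : b != a by rewrite gt_eqF.
have := even_pow_above_tangent d _ _ ed (neq _ h0).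
have := even_pow_above_tangent d _ _ ed (neq _ hb).
rewrite ea eb mulr0 sub0r -signr_odd /= negbK (negbTE ed) expr0.
(* [T * N] is the slope of s |-> (N s - 1)^(d+2) at a. Lying strictly above the tangent forces lam >
   [T * N] at b and lam < [T * N] at 0. *)
set T := _ * _ ^+ _ => ib i0; exfalso.
have : 0 < (lam - T * N) * (b - a) by move: ib; rewrite -subr_gt0; congr (0 < _); ring.
have : 0 < (T * N - lam) * a by move: i0; rewrite -subr_gt0; congr (0 < _); ring.
by rewrite !pmulr_lgt0 ?subr_gt0 // => /lt_trans h /h; rewrite ltxx.
Qed.

(** The equality of the two comparisons puts x and y on the same side of s*, where g(s)/s is
    strictly monotone. *)
Lemma gfun_ratio_inj {R : realType} n d (sstar x y : R) : is_sstar n d sstar ->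
  0 < x -> 0 < y -> (x <= sstar) = (y <= sstar) ->
  gfun n d x / x = gfun n d y / y -> x = y.
Proof.
move=> [_ [_ [dec inc]]]; wlog xy : x y / x <= y => [hw x0 y0 side e|].
  by have [xy|/ltW xy] := leP x y; [|symmetry]; apply: hw.
move=> x0 y0 side e; move: xy; rewrite le_eqVlt => /predU1P[//|xy].
have [ys|sy] := leP y sstar.
  by have := dec x y x0 xy ys; rewrite e ltxx.
have sx : sstar <= x by move: side; rewrite [in RHS]leNgt sy /= leNgt => /negbFE/ltW.
by have := inc x y sx xy; rewrite e ltxx.
Qed.

(** * Two nonzero weight values, for even order *)

Section TwoLevels.
Context {R : realType} {n : nat} {K1 K2 : {set 'I_n.+1}} (a b : R).
Hypotheses (n_gt0 : (0 < n)%N) (K12 : [disjoint K1 & K2]).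

Local Notation N := (n%:R + 1 : R).
Local Notation k1 := (#|K1|%:R : R).
Local Notation k2 := (#|K2|%:R : R).
Local Notation Q := (N * a ^+ 2 * k1 + N * b ^+ 2 * k2 - 1).

Definition two_level (k : 'I_n.+1) := a * (k \in K1)%:R + b * (k \in K2)%:R.

Lemma two_levelE k :
  two_level k = if k \in K1 then a else if k \in K2 then b else 0.
Proof.
rewrite /two_level; have [kK1|_] := boolP (k \in K1).
  by rewrite (disjointFr K12 kK1) mulr1 mulr0 addr0.
by case: (k \in K2); rewrite ?mulr1 !mulr0 add0r.
Qed.

Lemma simplex_comb_two_level :
  simplex_comb two_level = a *: sumK K1 + b *: sumK K2.
Proof.
rewrite -!simplex_comb_sumK // !simplex_combZ // /simplex_comb -big_split.
by apply: eq_bigr => k _; rewrite scalerDl.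
Qed.

Lemma sum_two_level : \sum_k two_level k = k1 * a + k2 * b.
Proof. by rewrite big_split /= !sum_mem. Qed.

Lemma sum_two_level_sqr : \sum_k two_level k ^+ 2 = k1 * a ^+ 2 + k2 * b ^+ 2.
Proof.
rewrite -!sum_mem -big_split; apply: eq_bigr => k _ /=; rewrite two_levelE.
have [kK1|_] := boolP (k \in K1).
  by rewrite (disjointFr K12 kK1) mulr1 mulr0 addr0.
by case: (k \in K2); rewrite ?mulr1 ?mulr0 ?add0r ?expr0n.
Qed.

Hypothesis level_sum : k1 * a + k2 * b = 1.

Lemma normv_two_level : normv (simplex_comb two_level) = Num.sqrt (Q / n%:R).
Proof.
rewrite normv_simplex_comb ?sum_two_level // sum_two_level_sqr.
by congr (Num.sqrt (_ / _)); ring.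
Qed.

Lemma simplex_dir_two_level : simplex_dir two_level
  = (Num.sqrt (Q / n%:R))^-1 *: (a *: sumK K1 + b *: sumK K2).
Proof. by rewrite /simplex_dir normv_two_level simplex_comb_two_level. Qed.

(** Positivity comes from the K2 term: b > 1/n gives N b > 1. The K1 term is an even power, and the
    remaining n + 1 - k1 - k2 counts the zero weights. *)
Lemma eigenpair_two_level d : ~~ odd d -> 0 < a -> n%:R^-1 < b -> K2 != set0 ->
  gfun n d.+2 a / a = gfun n d.+2 b / b ->
  let mu := (k1 * (N * a - 1) ^+ d.+2 + k2 * (N * b - 1) ^+ d.+2
                   + n%:R + 1 - k1 - k2)
            / (n%:R ^+ (d.+2 %/ 2) * Q ^+ (d.+2 %/ 2)) in
  eigenpair (simplexT R n d.+2)
    ((Num.sqrt (Q / n%:R))^-1 *: (a *: sumK K1 + b *: sumK K2)) mu /\ 0 < mu.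
Proof.
move=> ed a_gt0 nb K20 gab mu.
have n_pos : 0 < n%:R :> R by rewrite ltr0n.
have b_gt0 : 0 < b by apply: lt_trans nb; rewrite invr_gt0.
have Nb : 0 < N * b - 1.
  have : 0 < n%:R * b - 1 by rewrite subr_gt0 mulrC -ltr_pdivrMr // div1r.
  by move=> h; rewrite mulrDl mul1r addrAC addr_gt0.
have [k0 k0K2] := set0Pn _ K20.
pose lam := gfun n d.+2 a / a.
have lamb : lam = gfun n d.+2 b / b by [].
have level_k0 : two_level k0 = b by rewrite two_levelE k0K2 (disjointFl K12 k0K2).
have s1 : \sum_k two_level k = 1 by rewrite sum_two_level.
have s0 : N * two_level k0 != 1 by rewrite level_k0 -subr_eq0 gt_eqF.
have gl k : gfun n d.+2 (two_level k) = lam * two_level k.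
  rewrite two_levelE; case: ifP => _; first by rewrite /lam divfK ?gt_eqF.
  case: ifP => _; first by rewrite lamb divfK ?gt_eqF.
  by rewrite mulr0 /gfun mulr0 sub0r subrr.
have r_gt0 := normv_simplex_comb_gt0 n_gt0 _ _ s1 s0.
have Q_gt0 : 0 < Q.
  by move: r_gt0; rewrite normv_two_level sqrtr_gt0 pmulr_lgt0 ?invr_gt0.
have k12_le : k1 + k2 <= N.
  rewrite -natrD natr1 ler_nat -cardsUI (disjoint_setI0 K12) cards0 addn0.
  by rewrite -[leqRHS]card_ord max_card.
have k2_gt0 : 0 < k2 by rewrite ltr0n card_gt0.
split; last first.
  rewrite divr_gt0 ?mulr_gt0 ?exprn_gt0 //.
  have : 0 <= k1 * (N * a - 1) ^+ d.+2.
    by rewrite mulr_ge0 ?ler0n // exprn_even_ge0 //= negbK.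
  have : 0 < k2 * (N * b - 1) ^+ d.+2 by rewrite mulr_gt0 ?exprn_gt0.
  by move: k12_le; lra.
have := gfun_linear_eigenpair n_gt0 d _ _ _ s1 s0 gl.
rewrite simplex_dir_two_level normv_two_level; congr eigenpair.
(* As the exponent in [gfun] is odd, g(c) = lam c reads (N c - 1)^(d+1) = lam c - 1. *)
have pow c : c != 0 -> gfun n d.+2 c / c = lam ->
    (N * c - 1) ^+ d.+2 = (N * c - 1) * (lam * c - 1).
  move=> c0 <-; rewrite divfK // /gfun /= -[(-1) ^+ _]signr_odd /= ed expr1.
  by rewrite opprK addrK exprS.
have num : k1 * (N * a - 1) ^+ d.+2 + k2 * (N * b - 1) ^+ d.+2
    + n%:R + 1 - k1 - k2 = lam * Q.
  rewrite !pow ?gt_eqF // -[X in _ = lam * (_ - X)]level_sum.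
  transitivity (lam * (N * a ^+ 2 * k1 + N * b ^+ 2 * k2 - (k1 * a + k2 * b))
    + N * (1 - (k1 * a + k2 * b))); first by ring.
  by rewrite level_sum subrr mulr0 addr0.
rewrite /mu num; have Q0 : Q != 0 by rewrite gt_eqF.
have n0 : n%:R != 0 :> R by rewrite gt_eqF.
(* The norm sqrt(Q/n) occurs to the even power d, which becomes the integer power d/2 of Q/n. *)
rewrite -[d in LHS]odd_double_half (negbTE ed) add0n divn2 /=.
rewrite -mul2n exprM sqr_sqrtr; last by rewrite divr_ge0 ?ltW.
rewrite expr_div_n mul2n -addnn [_ ^+ (_ + _).+1]exprS exprD.
rewrite [n%:R ^+ _.+1]exprS [Q ^+ _.+1]exprS.
move: (expf_neq0 d./2 n0) (expf_neq0 d./2 Q0).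
move: Q0 (_ ^+ _) (_ ^+ _); move: Q => q q0 x y x0 y0.
by field; rewrite n0 q0 x0 y0.
Qed.

End TwoLevels.

(** * Assembly of the three cases *)

Lemma sum1_pos_term {R : realDomainType} (I : finType) (s : I -> R) :
  \sum_i s i = 1 -> (forall i, 0 <= s i) -> exists i, 0 < s i.
Proof.
move=> s1 s_ge0; have [i|s0] := pickP (fun i => 0 < s i); first by exists i.
move: s1; rewrite big1 => [/eqP|i _]; first by rewrite eq_sym oner_eq0.
by apply/eqP; move: (s0 i); rewrite lt_neqAle s_ge0 andbT eq_sym => /negbFE.
Qed.

Theorem mainTheorem6 (R : realType) (n d : nat) (hn : (2 <= n)%N) (hd : (2 <= d)%N) :
  (* (i) d = 2 *)
  (d = 2%N ->
     forall v : 'rV[R]_n, normv v = 1 ->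
       eigenpair (simplexT R n d) v (1 + (n%:R)^-1))
  /\
  (* (ii) d >= 3 odd *)
  ((3 <= d)%N -> odd d ->
     (forall v : 'rV[R]_n, normv v = 1 ->
        (is_eigenvector (simplexT R n d) v <->
         exists K : {set 'I_n.+1}, [/\ K != set0, (#|K| <= n)%N &
            v = (normv (sumK K))^-1 *: sumK K]))
     /\
     (forall K : {set 'I_n.+1}, K != set0 -> (#|K| <= n)%N ->
        let k := (#|K|)%:R : R in
        let mu := ((n%:R + 1 - k) ^+ d.-1 - k ^+ d.-1) /
                  (Num.sqrt (n%:R) ^+ d * Num.sqrt (k * (n%:R + 1 - k)) ^+ (d - 2)) in
        [/\ normv (sumK K) = Num.sqrt (k * (n%:R + 1 - k) / n%:R),
            eigenpair (simplexT R n d) ((normv (sumK K))^-1 *: sumK K) mu &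
            (mu = 0 <-> (2 * #|K| = n.+1)%N)])
     /\
     (~~ odd n -> forall (v : 'rV[R]_n) (mu : R), normv v = 1 ->
        eigenpair (simplexT R n d) v mu -> mu != 0))
  /\
  (* (iii) d >= 4 even *)
  ((4 <= d)%N -> ~~ odd d -> forall sstar : R, is_sstar n d sstar ->
     (forall v : 'rV[R]_n, normv v = 1 ->
        (is_eigenvector (simplexT R n d) v <->
         (exists K : {set 'I_n.+1}, [/\ K != set0, (#|K| <= n)%N &
             v = (normv (sumK K))^-1 *: sumK K])
         \/
         (exists (K1 K2 : {set 'I_n.+1}) (a b : R),
             [/\ K1 != set0, K2 != set0, [disjoint K1 & K2],
                 (#|K1| <= n)%N & (#|K2| <= n)%N] /\
             [/\ 0 < a, a <= sstar, sstar < b & b <= 1] /\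
             (#|K1|%:R * a + #|K2|%:R * b = 1) /\
             (gfun n d a / a = gfun n d b / b) /\
             v = (Num.sqrt (((n%:R + 1) * a ^+ 2 * #|K1|%:R
                             + (n%:R + 1) * b ^+ 2 * #|K2|%:R - 1) / n%:R))^-1
                 *: (a *: sumK K1 + b *: sumK K2))))
     /\
     (forall K : {set 'I_n.+1}, K != set0 -> (#|K| <= n)%N ->
        let k := (#|K|)%:R : R in
        let mu := ((n%:R + 1 - k) ^+ d.-1 + k ^+ d.-1) /
                  ((n%:R) ^+ (d %/ 2) * (k * (n%:R + 1 - k)) ^+ (d %/ 2 - 1)) in
        eigenpair (simplexT R n d) ((normv (sumK K))^-1 *: sumK K) mu /\ 0 < mu)
     /\
     (forall (K1 K2 : {set 'I_n.+1}) (a b : R),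
        [/\ K1 != set0, K2 != set0, [disjoint K1 & K2],
            (#|K1| <= n)%N & (#|K2| <= n)%N] ->
        [/\ 0 < a, a <= sstar, sstar < b & b <= 1] ->
        #|K1|%:R * a + #|K2|%:R * b = 1 ->
        gfun n d a / a = gfun n d b / b ->
        let k1 := (#|K1|)%:R : R in
        let k2 := (#|K2|)%:R : R in
        let Q := (n%:R + 1) * a ^+ 2 * k1 + (n%:R + 1) * b ^+ 2 * k2 - 1 in
        let mu := (k1 * ((n%:R + 1) * a - 1) ^+ d + k2 * ((n%:R + 1) * b - 1) ^+ d
                   + n%:R + 1 - k1 - k2) / ((n%:R) ^+ (d %/ 2) * Q ^+ (d %/ 2)) in
        eigenpair (simplexT R n d)
          ((Num.sqrt (Q / n%:R))^-1 *: (a *: sumK K1 + b *: sumK K2)) mu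
        /\ 0 < mu)).
Proof.
have n_gt0 : (0 < n)%N by apply: leq_trans hn.
have n_pos : 0 < n%:R :> R by rewrite ltr0n.
have n_neq0 : n%:R != 0 :> R by rewrite gt_eqF.
case: d hd => [//|[//|d]] _; split; [|split].
(* For d = 2 the contraction is the tight frame sum, and N/n = 1 + 1/n. *)
- case=> -> v v1; split.
    by apply/eqP => v0; move/eqP: v1; rewrite v0 normv0 eq_sym oner_eq0.
  rewrite tcontract_simplexT; under eq_bigr do rewrite expr1.
  by rewrite simplex_tight_frame // mulrDl divff // mul1r.
- case: d => [//|d] _ odd_d; have ed : ~~ odd d by move: odd_d; rewrite /= negbK.
  have forward (v : 'rV[R]_n) : normv v = 1 -> is_eigenvector (simplexT R n d.+3) v ->
      exists K : {set 'I_n.+1}, [/\ K != set0, (#|K| <= n)%N &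
            v = (normv (sumK K))^-1 *: sumK K].
    move=> /(unit_simplex_dir n_gt0)[s [s1 s_ge0 [k0 s0] ->]].
    move=> /(eigenvector_gfun_linear n_gt0 _ _ _ s1 s0)[lam gl].
    have [k1 k1_gt0] := sum1_pos_term _ _ s1 s_ge0.
    (* K is the support of s; by convexity all positive weights equal s k1. *)
    exists [set k | 0 < s k].
    apply: (simplex_dir_one_level s _ (s k1) k0 s1 s0) => // k.
    rewrite inE; have [k_gt0|] := ltP 0 (s k); last first.
      by move=> /(conj (s_ge0 k))/andP/le_anti <-; rewrite mulr0.
    by rewrite mulr1; apply: (gfun_odd_linear_inj n d lam).
  have formula (K : {set 'I_n.+1}) : K != set0 -> (#|K| <= n)%N ->
    let k := (#|K|)%:R : R in
    let mu := ((n%:R + 1 - k) ^+ d.+2 - k ^+ d.+2) /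
              (Num.sqrt (n%:R) ^+ d.+3 * Num.sqrt (k * (n%:R + 1 - k)) ^+ d.+1) in
    eigenpair (simplexT R n d.+3) ((normv (sumK K))^-1 *: sumK K) mu
    /\ (mu = 0 <-> (2 * #|K| = n.+1)%N).
    move=> K0 Kn k mu; split.
      rewrite /mu; have := eigenpair_sumK (R := R) n_gt0 d.+1 K K0 Kn; rewrite -/k /= [(- k) ^+ _]exprNn.
      by rewrite -signr_odd /= negbK (negbTE ed) mul1r.
    have k_gt0 : 0 < k by rewrite ltr0n card_gt0.
    have Nk_gt0 : 0 < n%:R + 1 - k by rewrite subr_gt0 natr1 ltr_nat ltnS.
    have den : Num.sqrt n%:R ^+ d.+3 * Num.sqrt (k * (n%:R + 1 - k)) ^+ d.+1 != 0.
      by rewrite mulf_neq0 // expf_neq0 // gt_eqF // sqrtr_gt0 // mulr_gt0.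
    (* Both bases are positive, so equal powers mean equal bases. *)
    transitivity (n%:R + 1 - k = k).
      split=> [/eqP|e]; last by rewrite /mu e subrr mul0r.
      rewrite /mu mulf_eq0 invr_eq0 (negbTE den) orbF subr_eq0.
      by rewrite eqrXn2 ?ltW // => /eqP.
    split=> [/eqP|/(congr1 (fun m => m%:R : R))].
      by rewrite subr_eq -natrD natr1 eqr_nat mul2n -addnn => /eqP/esym.
    by rewrite /= natrM -[n.+1%:R]natr1 -/k => <-; ring.
  split; last split.
  + move=> v v1; split=> [|[K [K0 Kn ->]]]; first exact: forward.
    by eexists; apply: (formula K K0 Kn).1.
  + move=> K K0 Kn k mu; have [pair mu0] := formula K K0 Kn; split=> //.
    exact: normv_sumK.
  (* By uniqueness mu is the value in [formula], and 2|K| = n + 1 is impossible for even n by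
     parity. *)
  + move=> en v mu v1 pair.
    have [|K [K0 Kn vE]] := forward v v1; first by exists mu.
    have [] := formula K K0 Kn; rewrite -vE => /(eigenvalue_uniq _ _ _ _ _ _ _ pair) <-.
    move=> mu0; apply/eqP => /mu0 /(congr1 odd).
    by rewrite mul2n odd_double /= en.
- move=> _ even_d sstar star; have ed : ~~ odd d by move: even_d; rewrite /= negbK.
  have [nstar _] := star.
  have star_gt0 : 0 < sstar by apply: lt_le_trans nstar; rewrite invr_gt0.
  have pairK (K : {set 'I_n.+1}) : K != set0 -> (#|K| <= n)%N ->
        let k := (#|K|)%:R : R in
        let mu := ((n%:R + 1 - k) ^+ d.+1 + k ^+ d.+1) /
                  ((n%:R) ^+ (d.+2 %/ 2) * (k * (n%:R + 1 - k)) ^+ (d.+2 %/ 2 - 1)) in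
        eigenpair (simplexT R n d.+2) ((normv (sumK K))^-1 *: sumK K) mu /\ 0 < mu.
    move=> K0 Kn k mu.
    have k_gt0 : 0 < k by rewrite ltr0n card_gt0.
    have Nk_gt0 : 0 < n%:R + 1 - k by rewrite subr_gt0 natr1 ltr_nat ltnS.
    split; last first.
      by rewrite divr_gt0 ?addr_gt0 ?mulr_gt0 ?exprn_gt0 // mulr_gt0.
    have := eigenpair_sumK (R := R) n_gt0 d K K0 Kn; congr eigenpair; rewrite -/k /mu.
    congr (_ / (_ * _)).
    + by rewrite exprNn -signr_odd /= ed expr1 mulN1r opprK.
    + rewrite -[in LHS](odd_double_half d) (negbTE ed) add0n divn2 /= -doubleS.
      by rewrite -mul2n exprM sqr_sqrtr ?ltW.
    + rewrite -[in LHS](odd_double_half d) (negbTE ed) add0n divn2 /= subn1 /=.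
      by rewrite -mul2n exprM sqr_sqrtr ?ltW ?mulr_gt0.
  have pair12 (K1 K2 : {set 'I_n.+1}) a b K12 K20 a_gt0 b_gt level_sum gab :=
    @eigenpair_two_level R n K1 K2 a b n_gt0 K12 level_sum d ed a_gt0 b_gt K20 gab.
  split; last split => //; last first.
    move=> K1 K2 a b [K10 K20 K12 _ _] [a_gt0 _ b_gt _] level_sum gab.
    by apply: pair12 => //; apply: le_lt_trans b_gt.
  move=> v v1; split; last first.
    case=> [[K [K0 Kn ->]]|[K1 [K2 [a [b]]]]].
      by eexists; apply: (pairK K K0 Kn).1.
    case=> -[K10 K20 K12 _ _] [[a_gt0 _ b_gt _]] [level_sum] [gab ->].
    by eexists; apply: (pair12 _ _ _ _ K12 K20 a_gt0 _ level_sum gab).1; apply: le_lt_trans b_gt.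
  have [s [s1 s_ge0 [k0 s0] ->]] := unit_simplex_dir n_gt0 v v1.
  move=> /(eigenvector_gfun_linear n_gt0 _ _ _ s1 s0)[lam gl].
  have ratio k : 0 < s k -> gfun n d.+2 (s k) / s k = lam.
    by move=> sk; rewrite gl mulfK // gt_eqF.
  (* The support of s is split at s*. All ratios g(s k) / s k equal lam, so s is constant on each
     part. *)
  pose K1 := [set k | (0 < s k) && (s k <= sstar)]; pose K2 := [set k | sstar < s k].
  have s_pos k : (0 < s k) = (k \in K1) || (k \in K2).
    rewrite !inE [sstar < _]ltNge; have [sk|sk] := leP (s k) sstar.
      by rewrite andbT orbF.
    by rewrite orbT (lt_trans star_gt0).
  have K2_pos k : k \in K2 -> 0 < s k by move=> kK; rewrite s_pos kK orbT.
  have K1_pos k : k \in K1 -> 0 < s k by move=> kK; rewrite s_pos kK.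
  have s_out k : (k \in K1) || (k \in K2) = false -> s k = 0.
    by rewrite -s_pos => /negbT; rewrite -leNgt => /(conj (s_ge0 k))/andP/le_anti/esym.
  have K1_eq k j : k \in K1 -> j \in K1 -> s k = s j.
    rewrite !inE => /andP[sk ks] /andP[sj js].
    by apply: (gfun_ratio_inj _ _ _ _ _ star) => //; rewrite ?ratio // ks js.
  have K2_eq k j : k \in K2 -> j \in K2 -> s k = s j.
    move=> kK jK; have [sk sj] := (K2_pos k kK, K2_pos j jK).
    apply: (gfun_ratio_inj _ _ _ _ _ star) => //; rewrite ?ratio //.
    by move: kK jK; rewrite !inE !leNgt => -> ->.
  have K12 : [disjoint K1 & K2].
    rewrite -setI_eq0; apply/eqP/setP => k; rewrite !inE [sstar < _]ltNge.
    by case: (s k <= sstar); rewrite ?andbF.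
  have one_level (K : {set 'I_n.+1}) k1 : k1 \in K -> (forall k, k \in K -> s k = s k1) ->
      (forall k, k \notin K -> s k = 0) -> 0 < s k1 ->
      exists K : {set 'I_n.+1}, [/\ K != set0, (#|K| <= n)%N &
             simplex_dir s = (normv (sumK K))^-1 *: sumK K].
    move=> k1K inK outK sk1; exists K.
    apply: (simplex_dir_one_level s _ (s k1) k0 s1 s0) => // k.
    by have [/inK ->|/outK ->] := boolP (k \in K); rewrite ?mulr1 ?mulr0.
  (* If either part is empty, a single level remains and case (a) holds. *)
  have [K20|[k2 k2K]] := set_0Vmem K2.
    left; have [k1 k1_gt0] := sum1_pos_term _ _ s1 s_ge0.
    have k1K : k1 \in K1 by move: k1_gt0; rewrite s_pos K20 in_set0 orbF.
    apply: (one_level K1 k1) => // k kK; first exact: K1_eq.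
    by apply: s_out; rewrite (negbTE kK) K20 in_set0.
  have [K10|[k1 k1K]] := set_0Vmem K1.
    left; apply: (one_level K2 k2) => // [k kK|k kK|]; [exact: K2_eq| |exact: K2_pos].
    by apply: s_out; rewrite (negbTE kK) K10 in_set0.
  right; exists K1, K2, (s k1), (s k2).
  have sE : s =1 two_level (s k1) (s k2) (K1 := K1) (K2 := K2).
    move=> k; rewrite two_levelE //; have [kK1|kK1] := ifP; first exact: K1_eq.
    have [kK2|kK2] := ifP; first exact: K2_eq.
    by apply: s_out; rewrite kK1 kK2.
  have level_sum : #|K1|%:R * s k1 + #|K2|%:R * s k2 = 1.
    rewrite -sum_two_level -s1; apply: eq_bigr => k _; exact/esym/sE.
  (* The index of zero weight lies outside both sets, which bounds their cardinalities by n. *)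
  have k0K : (k0 \in K1) || (k0 \in K2) = false by rewrite -s_pos s0 ltxx.
  have [k0K1 k0K2] : k0 \notin K1 /\ k0 \notin K2.
    by move/negbT: k0K; rewrite negb_or => /andP.
  split; [|split; [|split; [|split]]] => //.
  + split=> //; [by apply/set0Pn; exists k1|by apply/set0Pn; exists k2| |].
      exact: card_of_notin k0K1.
    exact: card_of_notin k0K2.
  + have k1K' := k1K; have k2K' := k2K.
    move: k1K' k2K'; rewrite !inE => /andP[sk1 k1s] sk2; split=> //.
    (* b <= 1 because b is one term of a nonnegative sum equal to 1. *)
    rewrite -s1 (bigD1 k2) //= lerDl; exact: sumr_ge0.
  + by rewrite !ratio //; [exact: K2_pos|exact: K1_pos].
  + by rewrite (eq_simplex_dir _ _ sE) simplex_dir_two_level.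
Qed.
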